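(* Let $\mathcal{C}$ be the emission coordinate region of a positioning system in Minkowski space-time with emitter world-lines $\gamma_A(\tau^A)$. Let $x\in\mathcal{C}$ belong to the space-like or to the null configuration region, i.e. $\epsilon\chi^2\le0$ where $\chi$ is the configuration vector at $x$. Then the orientation $\hat\epsilon=\mathrm{sgn}\,{*}(m_1\wedge m_2\wedge m_3\wedge m_4)$ of the positioning system with respect to $x$ is $$\hat\epsilon=\mathrm{sgn}(u\cdot\chi)$$ for any future-pointing time-like vector $u$.
   Context: Minkowski space-time is identified, via a choice of origin of an inertial chart, with a 4-dimensional real oriented and time-oriented vector space with Lorentzian inner product $\cdot$ of signature $2\epsilon$, $\epsilon=\pm1$ fixed ($\epsilon=+1$: $(-,+,+,+)$; $\epsilon=-1$: $(+,-,-,-)$). Write $v^2=v\cdot v$. A vector $v$ is time-like if $\epsilon v^2<0$; a time-like or nonzero null vector $v$ is future-pointing iff $\epsilon\,u\cdot v<0$ for a future-pointing time-like $u$. Let $\eta$ be the metric volume form. Conventions: ${*}(v_1\wedge v_2\wedge v_3\wedge v_4)=\eta(v_1,v_2,v_3,v_4)$; ${*}(v_1\wedge v_2\wedge v_3)$ is the vector $w$ with $w\cdot u=\eta(u,v_1,v_2,v_3)$ for all $u$. Positioning system: four distinct smooth future-directed time-like curves $\gamma_A(\tau^A)$ parametrized by proper time. The emission region is the set of $x$ for which there are values $\tau^A$ such that each $m_A=x-\gamma_A(\tau^A)$ satisfies $m_A^2=0$ and $\epsilon\,u\cdot m_A<0$ (future-pointing null). The emission coordinate region $\mathcal{C}$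 is the set of such $x$ with $m_1\wedge m_2\wedge m_3\wedge m_4\neq0$. For $x\in\mathcal{C}$, $\gamma_A=\gamma_A(\tau^A)$, $e_a=\gamma_a-\gamma_4$ ($a=1,2,3$), and $\chi={*}(e_1\wedge e_2\wedge e_3)$ is the configuration vector. The space-like configuration region is $\mathcal{C}_s=\{x\in\mathcal{C}:\epsilon\chi^2<0\}$, the null one is $\mathcal{C}_\ell=\{x\in\mathcal{C}:\chi^2=0\}$. *)

(* Defs.v *)
From HB Require Import structures.
From mathcomp Require Import all_boot all_order all_algebra.
From mathcomp Require Import all_classical all_reals all_analysis.

Set Implicit Arguments.
Unset Strict Implicit.
Unset Printing Implicit Defensive.

Import Order.TTheory GRing.Theory Num.Theory.
Import numFieldNormedType.Exports.

Local Open Scope classical_set_scope.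
Local Open Scope ring_scope.

(* Minkowski space-time with a chosen origin, so that events are vectors.
   [frame] is an arbitrary basis: it represents the orientation (it need not be
   orthonormal). [arrow] is a time-like vector representing the time
   orientation. [signature] (+1 or -1) is the sign called epsilon below. *)
Record minkowski_spacetime (R : realType) := Minkowski {
  spacetime :> vectType R;
  signature : R;
  dot : {symmetric spacetime};
  frame : 4.-tuple spacetime;
  arrow : spacetime;
  signatureP : signature = 1 \/ signature = -1;
  dot_lorentzian : exists e : 4.-tuple spacetime,
    basis_of fullv e /\
    forall i j : 'I_4, dot (tnth e i) (tnth e j) =
      if i == j then (if i == ord0 then - signature else signature) else 0;
  frame_basis : basis_of fullv frame;
  arrow_timelike : signature * dot arrow arrow < 0 }.

Section Minkowski.
Variables (R : realType) (M : minkowski_spacetime R).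
Implicit Types u v w : M.

Definition timelike v := signature M * dot M v v < 0.
Definition null v := dot M v v = 0.

Definition future_pointing v :=
  (timelike v \/ (v != 0 /\ null v)) /\ signature M * dot M (arrow M) v < 0.

(* v_1 /\ ... /\ v_k, as an alternating k-linear form on the dual space:
   (a_1, ..., a_k) |-> det (a_i (v_j)). *)
Definition wedge k (v : 'I_k -> M) : ('I_k -> 'Hom(M, R^o)) -> R :=
  fun a => \det (\matrix_(i < k, j < k) (a i (v j) : R)).

(* The metric volume form sqrt |det g_ij| dx^1 /\ dx^2 /\ dx^3 /\ dx^4, with
   x^i the coordinates in the positively oriented basis [frame]. *)
Definition volume (v1 v2 v3 v4 : M) : R :=
  Num.sqrt `|\det (\matrix_(i < 4, j < 4)
                     dot M (tnth (frame M) i) (tnth (frame M) j))| *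
  \det (\matrix_(i < 4, j < 4) coord (frame M) i (tnth [tuple v1; v2; v3; v4] j)).

Definition star4 (v1 v2 v3 v4 : M) : R := volume v1 v2 v3 v4.

(* The unique w such that w . u = volume u v1 v2 v3 for all u; see [star3P]. *)
Definition star3 (v1 v2 v3 : M) : M :=
  xget 0 [set w | forall u, dot M w u = volume u v1 v2 v3].

Definition coordinate (c : R -> M) (i : 'I_4) : R -> R :=
  fun t => coord (frame M) i (c t).

(* To be used on open sets only. *)
Definition smooth_on (D : set R) (c : R -> M) :=
  forall (i : 'I_4) (n : nat) (t : R), D t ->
    derivable (derive1n n (coordinate c i)) t 1.

Definition velocity (c : R -> M) (t : R) : M :=
  \sum_(i < 4) derive1 (coordinate c i) t *: tnth (frame M) i.

Lemma volume_linear v1 v2 v3 : linear_for *%R (fun u => volume u v1 v2 v3).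
Proof.
move=> a u v; rewrite /volume.
rewrite -[X in _ * X = _]det_tr.
rewrite (@determinant_multilinear _ _ _
  (\matrix_(i < 4, j < 4) coord (frame M) i (tnth [tuple u; v1; v2; v3] j))^T
  (\matrix_(i < 4, j < 4) coord (frame M) i (tnth [tuple v; v1; v2; v3] j))^T
  ord0 a 1) ?det_tr ?mul1r ?mulrDr 1?mulrCA //.
- by apply/rowP => j; rewrite !mxE /= linearP mul1r.
- by apply/matrixP => i j; rewrite !mxE !(tnth_nth 0) /=.
- by apply/matrixP => i j; rewrite !mxE !(tnth_nth 0) /=.
Qed.

Lemma star3P v1 v2 v3 u : dot M (star3 v1 v2 v3) u = volume u v1 v2 v3.
Proof.
suff [w hw] : exists w, forall u', dot M w u' = volume u' v1 v2 v3.
  exact: (@xgetPex _ 0 [set w | forall u', dot M w u' = volume u' v1 v2 v3]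
            (ex_intro _ w hw)).
have [e [be de]] := dot_lorentzian M.
pose f := HB.pack_for {scalar M} (fun u' => volume u' v1 v2 v3)
  (GRing.isLinear.Build _ _ _ _ _ (volume_linear v1 v2 v3)).
have fE u' : volume u' v1 v2 v3 = f u' by [].
exists (\sum_i (dot M (tnth e i) (tnth e i) * f (tnth e i)) *: tnth e i) => u'.
rewrite fE (coord_basis be (memvf u')) linear_sumr raddf_sum.
apply: eq_bigr => j _; rewrite -!tnth_nth linearZr_LR [RHS]linearZ_LR /=.
congr (_ * _); rewrite linear_sumlz (bigD1 j) //= big1 ?addr0 => [|i ij].
  rewrite linearZl_LR /= mulrAC !de eqxx.
  by case: ifP; case: (signatureP M) => -> _; rewrite ?mulrNN ?mulr1 ?mul1r ?opprK.
by rewrite linearZl_LR /= (de i j) (negPf ij) mulr0.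
Qed.

End Minkowski.

(* [worldline A] only matters on [domain A], an open interval of proper time
   (possibly the whole line). *)
Record positioning_system (R : realType) (M : minkowski_spacetime R) := PositioningSystem {
  worldline : 'I_4 -> R -> M;
  domain : 'I_4 -> set R;
  domain_open : forall A, open (domain A);
  domain_interval : forall A, is_interval (domain A);
  domain_nonempty : forall A, domain A !=set0;
  worldline_smooth : forall A, smooth_on (domain A) (worldline A);
  worldline_future : forall A t, domain A t ->
    timelike (velocity (worldline A) t) /\
    future_pointing (velocity (worldline A) t);
  proper_time : forall A t, domain A t ->
    signature M * dot M (velocity (worldline A) t) (velocity (worldline A) t) = -1;
  worldline_distinct : forall A B, A != B ->
    worldline A @` domain A <> worldline B @` domain B }.

Section PositioningSystem.
Variables (R : realType) (M : minkowski_spacetime R) (P : positioning_system M).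

(* The vectors m_A; 'I_4 indexes the emitters, the fourth being [ord_max]. *)
Definition from_emitter (x : M) (tau : 'I_4 -> R) (A : 'I_4) : M :=
  x - worldline P A (tau A).

Definition emission_times (x : M) (tau : 'I_4 -> R) :=
  forall A, [/\ domain P A (tau A), null (from_emitter x tau A) &
                future_pointing (from_emitter x tau A)].

Definition emission_coordinates (x : M) (tau : 'I_4 -> R) :=
  emission_times x tau /\ wedge (from_emitter x tau) <> (fun=> 0).

Definition emission_coordinate_region : set M :=
  [set x | exists tau, emission_coordinates x tau].

(* The vectors e_a = gamma_a - gamma_4. *)
Definition relative_position (tau : 'I_4 -> R) (a : 'I_3) : M :=
  worldline P (lift ord_max a) (tau (lift ord_max a)) -
  worldline P ord_max (tau ord_max).

Definition configuration (tau : 'I_4 -> R) : M :=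
  star3 (relative_position tau (@Ordinal 3 0 isT))
        (relative_position tau (@Ordinal 3 1 isT))
        (relative_position tau (@Ordinal 3 2 isT)).

Definition spacelike_configuration_region : set M :=
  [set x | exists2 tau, emission_coordinates x tau &
     signature M * dot M (configuration tau) (configuration tau) < 0].

Definition null_configuration_region : set M :=
  [set x | exists2 tau, emission_coordinates x tau &
     dot M (configuration tau) (configuration tau) = 0].

Definition orientation (x : M) (tau : 'I_4 -> R) : R :=
  Num.sg (star4 (from_emitter x tau (@Ordinal 4 0 isT))
                (from_emitter x tau (@Ordinal 4 1 isT))
                (from_emitter x tau (@Ordinal 4 2 isT))
                (from_emitter x tau (@Ordinal 4 3 isT))).

End PositioningSystem.

(* Main.v *)
(* Write m_A for the null vectors from the emitters to x.  Since
   e_a = m_4 - m_a, the volume star4 m_1 m_2 m_3 m_4 equals chi . m_4; it is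
   nonzero because the m_A are independent.  If chi is causal then it lies, up
   to sign, in the closed future cone, so chi . m_4 and chi . u have the same
   sign: a vector orthogonal to a time-like one is zero or space-like.

   The emission times witnessing the hypotheses on x need not a priori be tau.
   They are: two emission times of one emitter would give null vectors m and
   m - d, with d a chord of its world-line, hence
   d^2 = 2 m . d = - 2 (m - d) . d.
   By the mean value theorem m . d and (m - d) . d have the same strict sign,
   that of the product of two future-pointing vectors, a contradiction. *)
Require Import Defs.
From HB Require Import structures.
From mathcomp Require Import all_boot all_order all_algebra perm.
From mathcomp Require Import all_classical all_reals all_analysis.
From mathcomp Require Import ring lra.

Set Implicit Arguments.
Unset Strict Implicit.
Unset Printing Implicit Defensive.

Import Order.TTheory GRing.Theory Num.Theory.
Import numFieldNormedType.Exports.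

Local Open Scope classical_set_scope.
Local Open Scope ring_scope.

(** * Determinants under subtraction of columns from the last one *)

Section DeterminantDifferences.
Variables (R : comPzRingType) (n : nat).
Implicit Type A : 'M[R]_n.+1.

(** These column operations are right multiplication by the lower triangular [T], whose diagonal is
    -1 repeated [n] times, then 1. *)
Lemma det_sub_from_last A :
  \det (\matrix_(i, j) (A i ord_max - (if j == ord_max then 0 else A i j))) =
  (-1) ^+ n * \det A.
Proof.
pose T : 'M[R]_n.+1 :=
  \matrix_(i, j) (if i == ord_max then 1 else - (i == j)%:R).
have -> : \matrix_(i, j) (A i ord_max - (if j == ord_max then 0 else A i j)) =
    A *m T.
  apply/matrixP => i j; rewrite !mxE (bigD1 ord_max) //= mxE eqxx mulr1.
  congr (_ + _); have [->|jmax] := eqVneq j ord_max.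
    rewrite oppr0 big1 // => k kmax.
    by rewrite mxE (negPf kmax) oppr0 mulr0.
  rewrite (bigD1 j) //= mxE (negPf jmax) eqxx mulrN1 big1 ?addr0 // => k.
  by case/andP => kmax kj; rewrite mxE (negPf kmax) (negPf kj) oppr0 mulr0.
rewrite det_mulmx mulrC; congr (_ * _).
rewrite det_trig.
  rewrite big_ord_recr /= mxE eqxx mulr1.
  under eq_bigr => i _ do
    rewrite mxE eqxx -val_eqE /= (ltn_eqF (ltn_ord i)).
  by rewrite prodr_const card_ord.
apply/is_trig_mxP => i j ij; rewrite mxE.
rewrite -!val_eqE /= (ltn_eqF ij) oppr0 ifF //.
by rewrite (ltn_eqF (leq_trans ij (leq_ord j))).
Qed.

(* Both the subtractions and the move of the last column to the front
   contribute a factor (-1)^n. *)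
Lemma det_last_minus_others A :
  \det (\matrix_(i, j) (A i ord_max -
    (if lift_perm ord0 ord_max 1%g j == ord_max then 0
     else A i (lift_perm ord0 ord_max 1%g j)))) = \det A.
Proof.
set s : 'S_n.+1 := lift_perm _ _ _.
have -> : \matrix_(i, j) (A i ord_max - (if s j == ord_max then 0 else A i (s j))) =
    col_perm s (\matrix_(i, j)
      (A i ord_max - (if j == ord_max then 0 else A i j))).
  by apply/matrixP => i j; rewrite !mxE.
rewrite col_permE det_mulmx det_perm det_sub_from_last odd_permV.
rewrite odd_lift_perm odd_perm1 /= addbF signr_odd.
by rewrite mulrC mulrA -exprD addnn -signr_odd odd_double mul1r.
Qed.

End DeterminantDifferences.

(** * Orthogonality to a time-like vector, in orthonormal coordinates *)

Section ReversedCauchySchwarz.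
Variable R : realFieldType.

Lemma cauchy_schwarz3 (a b c x y z : R) :
  (a * x + b * y + c * z) ^+ 2 <=
  (a ^+ 2 + b ^+ 2 + c ^+ 2) * (x ^+ 2 + y ^+ 2 + z ^+ 2).
Proof.
rewrite -subr_ge0.
suff -> : (a ^+ 2 + b ^+ 2 + c ^+ 2) * (x ^+ 2 + y ^+ 2 + z ^+ 2) -
    (a * x + b * y + c * z) ^+ 2 =
  (a * y - b * x) ^+ 2 + (a * z - c * x) ^+ 2 + (b * z - c * y) ^+ 2.
  by rewrite !addr_ge0 // sqr_ge0.
by ring.
Qed.

(** With [S] and [Y] the squared spatial norms, orthogonality and Cauchy-Schwarz give t0^2 y0^2 <= S
    Y <= S y0^2. Since S < t0^2, this forces y0 = 0, and then Y <= y0^2 kills the spatial part. *)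
Lemma lorentz_orthogonal_spacelike (t0 t1 t2 t3 y0 y1 y2 y3 : R) :
  - t0 ^+ 2 + (t1 ^+ 2 + t2 ^+ 2 + t3 ^+ 2) < 0 ->
  - (t0 * y0) + (t1 * y1 + t2 * y2 + t3 * y3) = 0 ->
  - y0 ^+ 2 + (y1 ^+ 2 + y2 ^+ 2 + y3 ^+ 2) <= 0 ->
  [/\ y0 = 0, y1 = 0, y2 = 0 & y3 = 0].
Proof.
move=> tT orth yC; have CS := cauchy_schwarz3 t1 t2 t3 y1 y2 y3.
have E : t1 * y1 + t2 * y2 + t3 * y3 = t0 * y0 by lra.
move: tT yC CS; rewrite E exprMn.
set S := t1 ^+ 2 + _ + _; set Y := y1 ^+ 2 + y2 ^+ 2 + y3 ^+ 2.
have S0 : 0 <= S by rewrite /S !addr_ge0 ?sqr_ge0.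
have Y0 : 0 <= Y by rewrite /Y !addr_ge0 ?sqr_ge0.
move=> tT yC CS.
have y00 : y0 ^+ 2 = 0.
  have y0_ge := sqr_ge0 y0.
  have : S * Y <= S * y0 ^+ 2 by rewrite ler_wpM2l //; lra.
  move=> SY; apply/eqP; rewrite eq_le y0_ge andbT leNgt; apply/negP => y0_gt.
  have : (t0 ^+ 2 - S) * y0 ^+ 2 > 0 by rewrite mulr_gt0 //; lra.
  by rewrite mulrBl; lra.
have Yz : Y = 0 by lra.
have [A1 A2 A3] : [/\ y1 ^+ 2 = 0, y2 ^+ 2 = 0 & y3 ^+ 2 = 0].
  have := sqr_ge0 y1; have := sqr_ge0 y2; have := sqr_ge0 y3.
  by move: Yz; rewrite /Y; split; lra.
by split; apply/eqP; rewrite -sqrf_eq0 ?y00 ?A1 ?A2 ?A3.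
Qed.

End ReversedCauchySchwarz.

(** * Signs of inner products of causal vectors *)

Section MinkowskiGeometry.
Variables (R : realType) (M : minkowski_spacetime R).
Implicit Types (u v w y : M) (a : R).

(** The product normalised to signature (-,+,+,+), which treats both values of epsilon at once. *)
Definition sdot v w := signature M * dot M v w.

Lemma sdotC v w : sdot v w = sdot w v.
Proof. by rewrite /sdot hermC expr0 mul1r. Qed.

Lemma sdotBr u v w : sdot u (v - w) = sdot u v - sdot u w.
Proof. by rewrite /sdot linearBr mulrBr. Qed.

Lemma sdotZr a v w : sdot v (a *: w) = a * sdot v w.
Proof. by rewrite /sdot linearZr_LR /= mulrCA. Qed.

Lemma sdotNr v w : sdot v (- w) = - sdot v w.
Proof. by rewrite -scaleN1r sdotZr mulN1r. Qed.

Lemma sdot0r v : sdot v 0 = 0.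
Proof. by rewrite -(scale0r v) sdotZr mul0r. Qed.

Lemma sdot_sumr (I : finType) v (F : I -> M) :
  sdot v (\sum_i F i) = \sum_i sdot v (F i).
Proof. by rewrite /sdot linear_sumr mulr_sumr. Qed.

Lemma sdotBB v w : sdot (v - w) (v - w) = sdot v v - sdot v w *+ 2 + sdot w w.
Proof.
by rewrite !sdotBr sdotC sdotBr [sdot (v - w) w]sdotC sdotBr [sdot w v]sdotC; ring.
Qed.

Lemma signature_sqr : signature M * signature M = 1.
Proof. by case: (signatureP M) => ->; rewrite ?mulrNN mulr1. Qed.

Lemma sdot_coordinates : exists e : 4.-tuple M,
  basis_of fullv e /\ forall v w, sdot v w =
    - (coord e ord0 v * coord e ord0 w) +
    (coord e (lift ord0 ord0) v * coord e (lift ord0 ord0) w +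
     coord e (lift ord0 (lift ord0 ord0)) v *
       coord e (lift ord0 (lift ord0 ord0)) w +
     coord e (lift ord0 (lift ord0 (lift ord0 ord0))) v *
       coord e (lift ord0 (lift ord0 (lift ord0 ord0))) w).
Proof.
have [e [be de]] := dot_lorentzian M; exists e; split=> // v w.
have dote i : sdot v (tnth e i) =
    coord e i v * (if i == ord0 then -1 else 1).
  rewrite sdotC {1}(coord_basis be (memvf v)) sdot_sumr (bigD1 i) //= big1.
    rewrite addr0 sdotZr -tnth_nth /sdot de eqxx.
    by case: ifP; rewrite ?mulrN signature_sqr.
  move=> j ji; rewrite sdotZr -tnth_nth /sdot de eq_sym (negPf ji).
  by rewrite !mulr0.
rewrite {1}(coord_basis be (memvf w)) sdot_sumr.
under eq_bigr do rewrite sdotZr -tnth_nth dote.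
by rewrite !big_ord_recl big_ord0 /=; ring.
Qed.

Lemma orthogonal_timelike_spacelike u y :
  timelike u -> sdot u y = 0 -> y != 0 -> 0 < sdot y y.
Proof.
have [e [be E]] := sdot_coordinates.
rewrite /timelike -/(sdot u u) => uT uy; apply: contraNT; rewrite -leNgt => yC.
move: uT uy yC; rewrite !E -!expr2 => uT uy yC.
have [y0 y1 y2 y3] := lorentz_orthogonal_spacelike uT uy yC.
apply/eqP; rewrite (coord_basis be (memvf y)) !big_ord_recl big_ord0.
by rewrite y0 y1 y2 y3 !scale0r !addr0.
Qed.

Lemma sdot_timelike_causal_neq0 u y :
  timelike u -> y != 0 -> sdot y y <= 0 -> sdot u y != 0.
Proof.
move=> uT y0 yC; apply/eqP => uy.
by have := orthogonal_timelike_spacelike uT uy y0; rewrite ltNge yC.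
Qed.

(** The combination v - s w orthogonal to u has s > 0 and a nonnegative square v^2 - 2 s v.w + s^2
    w^2. As v^2 and w^2 are nonpositive, v.w cannot be positive. *)
Lemma sdot_causal_le0 u v w : timelike u ->
  sdot v v <= 0 -> sdot w w <= 0 -> sdot u v < 0 -> sdot u w < 0 ->
  sdot v w <= 0.
Proof.
move=> uT vC wC uv uw.
pose s := sdot u v / sdot u w.
have s0 : 0 < s by rewrite /s nmulr_rgt0 ?invr_lt0.
have uy : sdot u (v - s *: w) = 0.
  by rewrite sdotBr sdotZr /s divfK ?subrr // lt_eqF.
have : 0 <= sdot (v - s *: w) (v - s *: w).
  have [->|y0] := eqVneq (v - s *: w) 0; first by rewrite sdot0r.
  by apply/ltW/(orthogonal_timelike_spacelike uT).
rewrite sdotBB sdotZr [sdot (s *: w) _]sdotZr [sdot (s *: w) w]sdotC sdotZr.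
move=> H; rewrite leNgt; apply/negP => vw.
have : 0 < s * sdot v w by rewrite mulr_gt0.
have : s * (s * sdot w w) <= 0 by rewrite 2?pmulr_rle0.
by lra.
Qed.

Lemma future_pointing_causal v :
  future_pointing v -> v != 0 /\ sdot v v <= 0.
Proof.
case=> [[vT|[v0 vN]] _]; last by rewrite /sdot vN mulr0.
split; last exact: ltW.
by apply: contraTneq vT => ->; rewrite /timelike -/(sdot _ _) sdot0r ltxx.
Qed.

(** Comparing both vectors with [arrow] gives the weak inequality; it is strict because no nonzero
    causal vector is orthogonal to a time-like one. *)
Lemma sdot_future_lt0 u v :
  timelike u -> future_pointing u -> future_pointing v -> sdot u v < 0.
Proof.
move=> uT uF vF.
have [_ uC] := future_pointing_causal uF.
have [v0 vC] := future_pointing_causal vF.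
rewrite lt_neqAle sdot_timelike_causal_neq0 //=.
exact: (sdot_causal_le0 (arrow_timelike M) uC vC uF.2 vF.2).
Qed.

(** * Derivatives, volumes and wedge products in frame coordinates *)

Lemma coordinates_sum v : v = \sum_i coord (frame M) i v *: tnth (frame M) i.
Proof.
rewrite {1}(coord_basis (frame_basis M) (memvf v)).
by apply: eq_bigr => i _; rewrite -tnth_nth.
Qed.

Lemma is_derive_sdot v (c : R -> M) t :
  (forall i, derivable (coordinate c i) t 1) ->
  is_derive t 1 (fun s => sdot v (c s)) (sdot v (velocity c t)).
Proof.
move=> c_der.
have -> : (fun s => sdot v (c s)) =
    \sum_i (sdot v (tnth (frame M) i) \*: coordinate c i).
  apply/funext => s; rewrite {1}[c s]coordinates_sum sdot_sumr fct_sumE.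
  by apply: eq_bigr => i _; rewrite sdotZr mulrC.
have -> : sdot v (velocity c t) =
    \sum_i sdot v (tnth (frame M) i) *: derive1 (coordinate c i) t.
  by rewrite sdot_sumr; apply: eq_bigr => i _; rewrite sdotZr mulrC.
apply: is_derive_sum => i; apply: is_deriveZ.
by rewrite derive1E; apply/derivableP.
Qed.

Lemma volume_differences (m1 m2 m3 m4 : M) :
  volume m4 (m4 - m1) (m4 - m2) (m4 - m3) = volume m1 m2 m3 m4.
Proof.
rewrite /volume; congr (_ * _).
(* The permutation sends column 0 to the last one, where 0 is subtracted and m4 remains; the column
   of index k + 1 goes to that of index k and becomes a difference. *)
rewrite -[RHS]det_last_minus_others; congr (\det _).
apply/matrixP => i j; rewrite !mxE; case: (unliftP ord0 j) => [k ->|->].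
  rewrite lift_perm_lift perm1 [lift ord_max k == _]eq_sym (negPf (neq_lift _ _)).
  case: k => [[|[|[|//]]] lt_k3]; rewrite !(tnth_nth 0) /= linearB //=.
by rewrite lift_perm_id eqxx subr0.
Qed.

(** The matrix of the a_i(m_j) is that of the a_i on the frame times the coordinate matrix. This
    turns a nonzero wedge into a nonzero determinant in [volume]. *)
Lemma wedge_eq0 (m : 'I_4 -> M) :
  \det (\matrix_(i < 4, j < 4) coord (frame M) i (m j)) = 0 ->
  wedge m = fun=> 0.
Proof.
move=> m0; apply/funext => a; rewrite /wedge.
have -> : (\matrix_(i < 4, j < 4) (a i (m j) : R)) =
    (\matrix_(i < 4, j < 4) (a i (tnth (frame M) j) : R)) *m
    (\matrix_(i < 4, j < 4) coord (frame M) i (m j)).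
  apply/matrixP => i j; rewrite !mxE {1}[m j]coordinates_sum linear_sum.
  by apply: eq_bigr => k _; rewrite !mxE linearZ /= mulrC.
by rewrite det_mulmx m0 mulr0.
Qed.

End MinkowskiGeometry.

(** * Uniqueness of emission times, and the volume of the m_A *)

Section Emission.
Variables (R : realType) (M : minkowski_spacetime R) (P : positioning_system M).
Implicit Types (x : M) (tau : 'I_4 -> R).

(** The derivative of the product with [k] along the world-line is its product with a future
    time-like velocity, hence negative. *)
Lemma sdot_worldline_decreasing (A : 'I_4) (k : M) (s t : R) :
  future_pointing k -> domain P A s -> domain P A t -> s < t ->
  sdot k (worldline P A t - worldline P A s) < 0.
Proof.
move=> kF As At st.
have D r : r \in `[s, t] -> domain P A r.
  by rewrite in_itv /=; apply: domain_interval As At r.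
have der r : r \in `[s, t] ->
    is_derive r 1 (fun z => sdot k (worldline P A z))
      (sdot k (velocity (worldline P A) r)).
  move=> /D Ar; apply: is_derive_sdot => i.
  (* Order 0 in [smooth_on] is derivability of the coordinate itself. *)
  exact: (@worldline_smooth _ _ P A i 0 r Ar).
have der_oo r (rst : r \in `]s, t[) := der r (subset_itv_oo_cc rst).
rewrite sdotBr; have [|r rst ->] := MVT st der_oo.
  by apply: derivable_within_continuous => r /der[].
rewrite nmulr_rlt0 ?subr_gt0 // sdotC.
have [vT vF] := worldline_future (D r (subset_itv_oo_cc rst)).
exact: sdot_future_lt0.
Qed.

Lemma emission_times_nlt x (tau1 tau2 : 'I_4 -> R) A :
  emission_times P x tau1 -> emission_times P x tau2 -> ~~ (tau1 A < tau2 A).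
Proof.
move=> /(_ A)[A1 N1 F1] /(_ A)[A2 N2 F2]; apply/negP => tau12.
have mE : from_emitter P x tau2 A = from_emitter P x tau1 A -
    (worldline P A (tau2 A) - worldline P A (tau1 A)).
  by rewrite /from_emitter opprB addrA subrK.
have H1 := sdot_worldline_decreasing F1 A1 A2 tau12.
have H2 := sdot_worldline_decreasing F2 A1 A2 tau12.
have S1 : sdot (from_emitter P x tau1 A) (from_emitter P x tau1 A) = 0.
  by rewrite /sdot N1 mulr0.
have S2 : sdot (from_emitter P x tau2 A) (from_emitter P x tau2 A) = 0.
  by rewrite /sdot N2 mulr0.
move: H1 H2 S1 S2; rewrite mE.
move: (from_emitter P x tau1 A) (_ - worldline P A (tau1 A)) => m d.
by rewrite sdotBB [sdot (m - d) d]sdotC sdotBr [sdot d m]sdotC; lra.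
Qed.

Lemma emission_times_unique x (tau1 tau2 : 'I_4 -> R) :
  emission_times P x tau1 -> emission_times P x tau2 -> tau1 = tau2.
Proof.
move=> E1 E2; apply/funext => A; apply/eqP.
by rewrite eq_le !leNgt (emission_times_nlt A E1 E2) (emission_times_nlt A E2 E1).
Qed.

Lemma star4_from_emitter x tau :
  star4 (from_emitter P x tau (@Ordinal 4 0 isT))
        (from_emitter P x tau (@Ordinal 4 1 isT))
        (from_emitter P x tau (@Ordinal 4 2 isT))
        (from_emitter P x tau (@Ordinal 4 3 isT)) =
  dot M (configuration P tau) (from_emitter P x tau ord_max).
Proof.
rewrite /configuration star3P.
have eE a : relative_position P tau a =
    from_emitter P x tau ord_max - from_emitter P x tau (lift ord_max a).
  by rewrite /from_emitter opprB addrC addrA subrK.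
rewrite !eE volume_differences /star4.
by congr (volume (from_emitter _ _ _ _) (from_emitter _ _ _ _)
  (from_emitter _ _ _ _) (from_emitter _ _ _ _)); apply: val_inj.
Qed.

End Emission.

(** Lets signs of [dot] be compared through [sdot], with a common factor epsilon. *)
Lemma sgr_signature (R : realType) (M : minkowski_spacetime R) (a : R) :
  Num.sg a = signature M * Num.sg (signature M * a).
Proof.
by rewrite sgrM; case: (signatureP M) => ->;
  rewrite ?sgr1 ?sgrN1 ?mulN1r ?opprK ?mul1r.
Qed.

Theorem proposition9 (R : realType) (M : minkowski_spacetime R) (P : positioning_system M)
    (x : M) (tau : 'I_4 -> R)
    (x_emission_coordinate_region : emission_coordinate_region P x)
    (x_region : (spacelike_configuration_region P `|`
                 null_configuration_region P) x)
    (tau_x : emission_times P x tau)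
    (u : M) (u_timelike : timelike u) (u_future : future_pointing u) :
  orientation P x tau = Num.sg (dot M u (configuration P tau)).
Proof.
set chi := configuration P tau; set m := from_emitter P x tau ord_max.
have [wedge0 chiC] : wedge (from_emitter P x tau) <> (fun=> 0) /\
    sdot chi chi <= 0.
  case: x_region => -[tau' [tau'_x w0]];
    rewrite -(emission_times_unique tau_x tau'_x) in w0 * => H; split=> //.
    exact: ltW.
  by rewrite /sdot H mulr0.
rewrite /orientation star4_from_emitter -/chi -/m.
(* Were the Gram factor zero, [volume] would vanish and chi would be orthogonal to everything, so
   both signs would be 0. Otherwise a nonzero coordinate determinant gives a nonzero volume. *)
have [gram0|gram_neq0] := eqVneq (Num.sqrt `|\det (\matrix_(i < 4, j < 4)
    dot M (tnth (frame M) i) (tnth (frame M) j))|) 0.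
  have chi0 v : dot M chi v = 0 by rewrite star3P /volume gram0 mul0r.
  by rewrite chi0 hermC chi0 /= mulr0 sgr0.
have mchi_neq0 : sdot m chi != 0.
  rewrite sdotC /sdot -star4_from_emitter mulf_neq0 //.
    by case: (signatureP M) => ->; rewrite ?oppr_eq0 oner_neq0.
  rewrite mulf_neq0 //; apply/eqP => det0; apply: wedge0; apply: wedge_eq0.
  rewrite -[RHS]det0; congr (\det _); apply/matrixP => i j; rewrite !mxE.
  by case: j => [[|[|[|[|//]]]] lt_j4]; rewrite (tnth_nth 0) /=;
    congr (coord _ _ (from_emitter _ _ _ _)); apply: val_inj.
have chi_neq0 : chi != 0 by apply: contraNneq mchi_neq0 => ->; rewrite sdot0r.
have [_ _ m_future] := tau_x ord_max.
have [_ mC] := future_pointing_causal m_future.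
have um := sdot_future_lt0 u_timelike u_future m_future.
have uchi_neq0 := sdot_timelike_causal_neq0 u_timelike chi_neq0 chiC.
rewrite hermC expr0 mul1r !(sgr_signature M (dot M _ chi)); congr (_ * _).
rewrite -/(sdot m chi) -/(sdot u chi).
case: (ltgtP (sdot u chi) 0) uchi_neq0 => // uchi _.
  have : sdot m chi <= 0 by apply: (sdot_causal_le0 u_timelike).
  rewrite le_eqVlt (negPf mchi_neq0) /= => mchi.
  by rewrite !ltr0_sg.
(* Here u.chi > 0, so it is -chi that lies on the same side of u as m. *)
have : sdot m (- chi) <= 0.
  apply: (sdot_causal_le0 u_timelike) => //; last by rewrite sdotNr oppr_lt0.
  by rewrite sdotNr sdotC sdotNr opprK.
rewrite sdotNr oppr_le0 le_eqVlt eq_sym (negPf mchi_neq0) /= => mchi.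
by rewrite !gtr0_sg.
Qed.
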